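(* The space $\overline{T(\mathbf I)}$ has the strongly discrete approximation property (SDAP). Hence $T(\mathbf I)$, $T^{PL}(\mathbf I)$ and $T^{PM}(\mathbf I)$ have SDAP.
   Context: $\mathbf I=[0,1]$; $C(\mathbf I)$ is the space of continuous self-maps of $\mathbf I$ with the supremum metric $d$; $T(\mathbf I)$ is the set of transitive maps ($f$ is transitive if for all non-empty open $U,V\subset\mathbf I$ there is $n\ge1$ with $U\cap f^{-n}(V)\ne\emptyset$), $\overline{T(\mathbf I)}$ its closure, and $T^{PL}(\mathbf I)$, $T^{PM}(\mathbf I)$ the sets of piecewise linear, respectively piecewise monotone, transitive maps. A metric space $(X,d)$ has SDAP if for every continuous $\varepsilon:X\to(0,1)$, every compact metric space $K$ and every continuous $f:K\times\mathbb N\to X$ ($\mathbb N$ discrete), there exists a continuous $g:K\times\mathbb N\to X$ such that the family $\{g(K\times\{n\}):n\in\mathbb N\}$ is discrete in $X$ and $d(f(k,n),g(k,n))<\varepsilon(f(k,n))$ for all $(k,n)\in K\times\mathbb N$. *)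

(* Defs.v *)
From Stdlib Require Import Reals List.
From Coquelicot Require Import Coquelicot.
Open Scope R_scope.

Definition J : Type := { x : R | 0 <= x <= 1 }.
Definition jval (x : J) : R := proj1_sig x.

Definition cont_map (f : J -> J) : Prop :=
  forall x : J, forall e, 0 < e -> exists delta, 0 < delta /\
    forall y : J, Rabs (jval y - jval x) < delta -> Rabs (jval (f y) - jval (f x)) < e.

Definition CI (f : J -> J) : Prop := cont_map f.

(* Supremum metric d(f,g) = sup_{x in I} |f x - g x| (finite: values lie in [0,1]). *)
Definition dsup (f g : J -> J) : R :=
  real (Lub_Rbar (fun r => exists x : J, r = Rabs (jval (f x) - jval (g x)))).

Definition openI (U : J -> Prop) : Prop :=
  forall x : J, U x -> exists r, 0 < r /\ forall y : J, Rabs (jval y - jval x) < r -> U y.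

Definition transitive (f : J -> J) : Prop :=
  forall U V : J -> Prop, openI U -> openI V -> (exists x, U x) -> (exists y, V y) ->
    exists n : nat, (1 <= n)%nat /\ exists x : J, U x /\ V (Nat.iter n f x).

Definition TI (f : J -> J) : Prop := CI f /\ transitive f.

Definition TI_closure (f : J -> J) : Prop :=
  CI f /\ forall e, 0 < e -> exists g, TI g /\ dsup f g < e.

Definition partitionI (m : nat) (a : nat -> R) : Prop :=
  a 0%nat = 0 /\ a m = 1 /\ forall i, (i < m)%nat -> a i < a (S i).

Definition piecewise_linear (f : J -> J) : Prop :=
  exists (m : nat) (a : nat -> R), partitionI m a /\
    forall i, (i < m)%nat -> exists s c : R, forall x : J,
      a i <= jval x <= a (S i) -> jval (f x) = s * jval x + c.

Definition piecewise_monotone (f : J -> J) : Prop :=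
  exists (m : nat) (a : nat -> R), partitionI m a /\
    forall i, (i < m)%nat ->
      (forall x y : J, a i <= jval x -> jval x <= jval y -> jval y <= a (S i) ->
         jval (f x) <= jval (f y)) \/
      (forall x y : J, a i <= jval x -> jval x <= jval y -> jval y <= a (S i) ->
         jval (f y) <= jval (f x)).

Definition TPL (f : J -> J) : Prop := TI f /\ piecewise_linear f.
Definition TPM (f : J -> J) : Prop := TI f /\ piecewise_monotone f.

Definition is_metric {K : Type} (dK : K -> K -> R) : Prop :=
  (forall x y, 0 <= dK x y) /\ (forall x y, dK x y = 0 <-> x = y) /\
  (forall x y, dK x y = dK y x) /\ (forall x y z, dK x z <= dK x y + dK y z).

Definition openK {K : Type} (dK : K -> K -> R) (U : K -> Prop) : Prop :=
  forall x, U x -> exists r, 0 < r /\ forall y, dK x y < r -> U y.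

Definition compact_metric {K : Type} (dK : K -> K -> R) : Prop :=
  forall C : (K -> Prop) -> Prop,
    (forall U, C U -> openK dK U) -> (forall x, exists U, C U /\ U x) ->
    exists l : list (K -> Prop), (forall U, In U l -> C U) /\
      forall x, exists U, In U l /\ U x.

Definition cont_into {K : Type} (dK : K -> K -> R) (h : K -> (J -> J)) : Prop :=
  forall k e, 0 < e -> exists delta, 0 < delta /\
    forall k', dK k k' < delta -> dsup (h k) (h k') < e.

Definition cont_on (X : (J -> J) -> Prop) (eps : (J -> J) -> R) : Prop :=
  forall f, X f -> forall e, 0 < e -> exists delta, 0 < delta /\
    forall h, X h -> dsup f h < delta -> Rabs (eps h - eps f) < e.

Definition discrete_family (X : (J -> J) -> Prop) {K : Type}
    (g : K -> nat -> (J -> J)) : Prop :=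
  forall p, X p -> exists r, 0 < r /\
    forall n m, (exists k, dsup p (g k n) < r) -> (exists k, dsup p (g k m) < r) -> n = m.

(* Strongly discrete approximation property of the subspace X of (C(I), d).
   A continuous map K x N -> X (N discrete) is given in curried form: a family of
   continuous maps K -> X indexed by n. *)
Definition SDAP (X : (J -> J) -> Prop) : Prop :=
  forall eps : (J -> J) -> R,
    (forall f, X f -> 0 < eps f < 1) -> cont_on X eps ->
  forall (K : Type) (dK : K -> K -> R), is_metric dK -> compact_metric dK ->
  forall f : K -> nat -> (J -> J),
    (forall k n, X (f k n)) -> (forall n, cont_into dK (fun k => f k n)) ->
  exists g : K -> nat -> (J -> J),
    (forall k n, X (g k n)) /\ (forall n, cont_into dK (fun k => g k n)) /\
    discrete_family X g /\
    (forall k n, dsup (f k n) (g k n) < eps (f k n)).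

(* Main.v *)
Require Import Defs.
From Stdlib Require Import Reals List.
From Coquelicot Require Import Coquelicot.
From Stdlib Require Import Lra Lia ZArith ProofIrrelevance IndefiniteDescription.

(** Given [f] in the closure of the transitive maps, an amplitude [a] and a fine mesh [1/M], let [g]
    be the piecewise linear map whose value at [j/M] is [f(j/M) + a] for [j] even and [f(j/M) - a]
    for [j] odd, truncated to [[0,1]]. It depends continuously on [f] and [a]. Its slopes exceed [4]
    in absolute value, so iterates of any open set swallow a whole lap; a lap is mapped over the
    [a/2]-neighbourhood of its image under [f], hence over a neighbourhood of its image under a
    transitive map close to [f], so the iterates of a lap fill the interval. Hence [g] is transitive
    and piecewise linear, and one construction serves all four spaces.

    Take [a = eps f / 4] and meshes that at least halve from [n] to [n+1]. Near a given map [p] the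
    amplitudes stay away from [0], by continuity and positivity of [eps], and zigzags of amplitude
    at least [c] whose meshes differ by a factor at least [2] are [c/2] apart: so a small ball
    around [p] meets zigzags of at most one mesh. *)

(** * The interval and its continuous self-maps *)

Lemma jval_bounds (x : J) : 0 <= jval x <= 1.
Proof. exact (proj2_sig x). Qed.

Lemma jval_inj (x y : J) : jval x = jval y -> x = y.
Proof.
  destruct x as [x hx], y as [y hy]; simpl; intros ->.
  f_equal; apply proof_irrelevance.
Qed.

Lemma clamp_bounds (r : R) : 0 <= Rmax 0 (Rmin 1 r) <= 1.
Proof.
  split; [apply Rmax_l|].
  apply Rmax_lub; [lra | apply Rmin_l].
Qed.

Definition clamp (r : R) : J := exist _ (Rmax 0 (Rmin 1 r)) (clamp_bounds r).

Lemma jval_clamp (r : R) : 0 <= r <= 1 -> jval (clamp r) = r.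
Proof.
  intros hr; simpl.
  rewrite (Rmin_right 1 r), Rmax_right; lra.
Qed.

Lemma clamp_jval (x : J) : clamp (jval x) = x.
Proof. apply jval_inj, jval_clamp, jval_bounds. Qed.

Lemma clamp_nonexpansive (r s : R) :
  Rabs (jval (clamp r) - jval (clamp s)) <= Rabs (r - s).
Proof.
  simpl; unfold Rmax, Rmin.
  repeat destruct Rle_dec; split_Rabs; lra.
Qed.

Lemma dsup_is_lub (f g : J -> J) :
  is_lub_Rbar (fun r => exists x : J, r = Rabs (jval (f x) - jval (g x)))
    (Finite (dsup f g)).
Proof.
  unfold dsup.
  set (E := fun r => exists x : J, r = Rabs (jval (f x) - jval (g x))).
  destruct (Lub_Rbar_correct E) as [hub hleast].
  assert (hle1 : Rbar_le (Lub_Rbar E) 1).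
  { apply hleast; intros r [x ->]; simpl.
    generalize (jval_bounds (f x)) (jval_bounds (g x)); split_Rabs; lra. }
  assert (hge : Rbar_le (Rabs (jval (f (clamp 0)) - jval (g (clamp 0)))) (Lub_Rbar E)).
  { apply hub; now exists (clamp 0). }
  destruct (Lub_Rbar E); simpl in *; easy.
Qed.

Lemma dist_le_dsup (f g : J -> J) (x : J) : Rabs (jval (f x) - jval (g x)) <= dsup f g.
Proof. apply (proj1 (dsup_is_lub f g)); now exists x. Qed.

Lemma dsup_le (f g : J -> J) (b : R) :
  (forall x, Rabs (jval (f x) - jval (g x)) <= b) -> dsup f g <= b.
Proof.
  intros h; apply (proj2 (dsup_is_lub f g) (Finite b)).
  intros r [x ->]; apply h.
Qed.

Lemma dsup_triangle (f g h : J -> J) : dsup f h <= dsup f g + dsup g h.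
Proof.
  apply dsup_le; intros x.
  generalize (dist_le_dsup f g x) (dist_le_dsup g h x); split_Rabs; lra.
Qed.

Lemma dsup_refl (f : J -> J) : dsup f f = 0.
Proof.
  apply Rle_antisym.
  - apply dsup_le; intros x; rewrite Rminus_diag, Rabs_R0; lra.
  - apply Rle_trans with (2 := dist_le_dsup f f (clamp 0)), Rabs_pos.
Qed.

Lemma dsup_comm (f g : J -> J) : dsup f g = dsup g f.
Proof.
  apply Rle_antisym; apply dsup_le; intros x; rewrite Rabs_minus_sym; apply dist_le_dsup.
Qed.

Lemma cont_map_extend (f : J -> J) :
  cont_map f -> continuity (fun r => jval (f (clamp r))).
Proof.
  intros hf r e he.
  destruct (hf (clamp r) e he) as [d [hd h]].
  exists d; split; [exact hd|]; intros s [_ hs]; apply h.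
  apply Rle_lt_trans with (2 := hs), clamp_nonexpansive.
Qed.

Lemma cont_map_uniform (f : J -> J) (e : R) : cont_map f -> 0 < e ->
  exists delta, 0 < delta /\ forall x y : J,
    Rabs (jval x - jval y) < delta -> Rabs (jval (f x) - jval (f y)) < e.
Proof.
  intros hf he.
  destruct (@Heine_cor2 _ 0 1 (fun r _ => cont_map_extend f hf r) (mkposreal e he))
    as [[d hd] h].
  exists d; split; [exact hd|]; intros x y hxy.
  specialize (h _ _ (jval_bounds x) (jval_bounds y) hxy).
  now rewrite !clamp_jval in h.
Qed.

Definition lipschitz_on (L u v : R) (f : J -> J) : Prop :=
  forall x y : J, u <= jval x -> jval x <= jval y -> jval y <= v ->
    Rabs (jval (f x) - jval (f y)) <= L * (jval y - jval x).

Lemma lipschitz_on_weaken (K L u v : R) (f : J -> J) :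
  K <= L -> lipschitz_on K u v f -> lipschitz_on L u v f.
Proof. intros hKL h x y hx hxy hy; generalize (h x y hx hxy hy); nra. Qed.

Lemma lipschitz_on_glue (L u v w : R) (f : J -> J) :
  lipschitz_on L u v f -> lipschitz_on L v w f -> lipschitz_on L u w f.
Proof.
  intros hl hr x y hx hxy hy.
  destruct (Rle_lt_dec (jval y) v); [now apply hl|].
  destruct (Rle_lt_dec v (jval x)); [now apply hr|].
  assert (hv : jval (clamp v) = v).
  { generalize (jval_bounds x) (jval_bounds y); intros; apply jval_clamp; lra. }
  generalize (hl x (clamp v)) (hr (clamp v) y); rewrite hv; intros dl dr.
  specialize (dl ltac:(lra) ltac:(lra) ltac:(lra)).
  specialize (dr ltac:(lra) ltac:(lra) ltac:(lra)).
  replace (jval (f x) - jval (f y))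
    with ((jval (f x) - jval (f (clamp v))) + (jval (f (clamp v)) - jval (f y))) by ring.
  apply Rle_trans with (1 := Rabs_triang _ _); lra.
Qed.

Lemma affine_lipschitz_on (f : J -> J) (s c u v : R) :
  (forall x : J, u <= jval x <= v -> jval (f x) = s * jval x + c) ->
  lipschitz_on (Rabs s) u v f.
Proof.
  intros h x y hx hxy hy; rewrite !h by lra.
  replace (s * jval x + c - (s * jval y + c)) with (- (s * (jval y - jval x))) by ring.
  rewrite Rabs_Ropp, Rabs_mult, (Rabs_pos_eq (jval y - jval x)); lra.
Qed.

Lemma piecewise_linear_lipschitz_on (f : J -> J) :
  piecewise_linear f -> exists L, 0 < L /\ lipschitz_on L 0 1 f.
Proof.
  intros [m [a [[ha0 [ham _]] hlin]]].
  rewrite <- ham; clear ham.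
  induction m as [|m IH].
  - exists 1; split; [lra|]; intros x y hx hxy hy.
    rewrite (jval_inj x y), !Rminus_diag, Rabs_R0; lra.
  - destruct IH as [L [hL hinit]]; [auto|].
    destruct (hlin m) as [s [c hs]]; [lia|].
    assert (hs0 := Rabs_pos s).
    exists (L + Rabs s); split; [lra|].
    apply lipschitz_on_glue with (a m).
    + apply lipschitz_on_weaken with L; [lra | exact hinit].
    + apply lipschitz_on_weaken with (Rabs s); [lra|].
      exact (affine_lipschitz_on f s c _ _ hs).
Qed.

Lemma piecewise_linear_cont_map (f : J -> J) : piecewise_linear f -> cont_map f.
Proof.
  intros hf; destruct (piecewise_linear_lipschitz_on f hf) as [L [hL hlip]].
  intros x e he; exists (e / L); split; [now apply Rdiv_lt_0_compat|].
  intros y hy; apply Rlt_div_r in hy; [|lra].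
  generalize (jval_bounds x) (jval_bounds y); intros hx01 hy01.
  destruct (Rle_lt_dec (jval x) (jval y)) as [hxy | hxy].
  - rewrite Rabs_minus_sym; rewrite Rabs_pos_eq in hy by lra.
    apply Rle_lt_trans with (1 := hlip x y ltac:(lra) hxy ltac:(lra)); lra.
  - rewrite Rabs_left in hy by lra.
    apply Rle_lt_trans with (1 := hlip y x ltac:(lra) ltac:(lra) ltac:(lra)); lra.
Qed.

Lemma piecewise_linear_monotone (f : J -> J) : piecewise_linear f -> piecewise_monotone f.
Proof.
  intros [m [a [ha h]]]; exists m, a; split; [exact ha|].
  intros i hi; destruct (h i hi) as [s [c hs]].
  destruct (Rle_lt_dec 0 s) as [h0 | h0]; [left | right];
    intros x y h1 h2 h3; rewrite !hs by lra; nra.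
Qed.

Lemma TI_incl_closure (f : J -> J) : TI f -> TI_closure f.
Proof.
  intros hf; split; [apply hf|]; intros e he; exists f; split; [exact hf|].
  now rewrite dsup_refl.
Qed.

(** * Iterated coverings *)

Definition covers (g : J -> J) (n : nat) (U V : J -> Prop) : Prop :=
  forall z : J, V z -> exists x, U x /\ Nat.iter n g x = z.

Lemma covers_subset {g : J -> J} {n : nat} {U V W : J -> Prop} :
  (forall z, W z -> V z) -> covers g n U V -> covers g n U W.
Proof. intros hWV h z hz; exact (h z (hWV z hz)). Qed.

Lemma covers_trans {g : J -> J} {m n : nat} {U V W : J -> Prop} :
  covers g m U V -> covers g n V W -> covers g (n + m) U W.
Proof.
  intros hm hn z hz.
  destruct (hn z hz) as [y [hy <-]], (hm y hy) as [x [hx <-]].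
  exists x; split; [exact hx | apply Nat.iter_add].
Qed.

Definition segment (u v : J) : J -> Prop := fun x => jval u <= jval x <= jval v.

Lemma cont_map_covers_segment (g : J -> J) (u v : J) : cont_map g -> jval u <= jval v ->
  covers g 1 (segment u v)
    (fun z => segment (g u) (g v) z \/ segment (g v) (g u) z).
Proof.
  intros hg huv z hz.
  destruct (IVT_gen _ (jval u) (jval v) (jval z) (cont_map_extend g hg)) as [r [hr hrz]].
  { rewrite !clamp_jval; revert hz; unfold segment, Rmin, Rmax.
    repeat destruct Rle_dec; lra. }
  rewrite Rmin_left, Rmax_right in hr by exact huv.
  generalize (jval_bounds u) (jval_bounds v); intros.
  exists (clamp r); split; [|now apply jval_inj].
  unfold segment; rewrite jval_clamp; lra.
Qed.

Definition ballJ (c : J) (r : R) : J -> Prop := fun x => Rabs (jval x - jval c) < r.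

Lemma ballJ_open (c : J) (r : R) : openI (ballJ c r).
Proof.
  unfold ballJ; intros x hx; exists (r - Rabs (jval x - jval c)); split; [lra|].
  intros y hy; split_Rabs; lra.
Qed.

(** * Laps of an equidistant mesh *)

Definition lap (M j : nat) : J -> Prop :=
  fun x => INR j <= INR M * jval x <= INR j + 1.

Definition node (M j : nat) : J := clamp (INR j / INR M).

Lemma mult_jval_node (M j : nat) : (0 < M)%nat -> (j <= M)%nat ->
  INR M * jval (node M j) = INR j.
Proof.
  intros hM hj; apply lt_0_INR in hM; apply le_INR in hj.
  unfold node; rewrite jval_clamp; [field; lra|]; split.
  - apply Rdiv_le_0_compat; [apply pos_INR | exact hM].
  - apply Rle_div_l; lra.
Qed.

Lemma lap_node_left (M j : nat) : (0 < M)%nat -> (j <= M)%nat -> lap M j (node M j).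
Proof. intros hM hj; unfold lap; rewrite mult_jval_node by assumption; lra. Qed.

Lemma lap_node_right (M j : nat) : (j < M)%nat -> lap M j (node M (S j)).
Proof. intros hj; unfold lap; rewrite mult_jval_node, S_INR by lia; lra. Qed.

Lemma lap_diameter (M j : nat) (x y : J) : lap M j x -> lap M j y ->
  INR M * Rabs (jval x - jval y) <= 1.
Proof.
  unfold lap; intros hx hy.
  rewrite <- (Rabs_pos_eq (INR M)), <- Rabs_mult by apply pos_INR.
  apply Rabs_le; lra.
Qed.

Definition lap_index (M : nat) (x : J) : nat := Z.to_nat (Int_part (INR M * jval x)).

Lemma lap_index_bounds (M : nat) (x : J) :
  INR (lap_index M x) <= INR M * jval x < INR (lap_index M x) + 1.
Proof.
  unfold lap_index; destruct (base_Int_part (INR M * jval x)) as [hle hgt].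
  assert (hpos : 0 <= INR M * jval x) by (apply Rmult_le_pos; [apply pos_INR | apply jval_bounds]).
  assert (hz : (0 <= Int_part (INR M * jval x))%Z).
  { assert (-1 < Int_part (INR M * jval x))%Z; [apply lt_IZR; lra | lia]. }
  rewrite INR_IZR_INZ, Z2Nat.id by exact hz; lra.
Qed.

Lemma lap_exists (M : nat) (x : J) : (0 < M)%nat -> exists j, (j < M)%nat /\ lap M j x.
Proof.
  intros hM; assert (hM' := lt_0_INR M hM); assert (hx := jval_bounds x).
  destruct (Rle_lt_dec 1 (jval x)) as [h | h].
  - exists (M - 1)%nat; split; [lia|].
    unfold lap; rewrite minus_INR by lia; simpl; replace (jval x) with 1 by lra; lra.
  - assert (hi := lap_index_bounds M x).
    exists (lap_index M x); split; [apply INR_lt; nra | unfold lap; lra].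
Qed.

Lemma lap_contains_ball (M j : nat) : (j < M)%nat ->
  exists c r, 0 < r /\ forall x, ballJ c r x -> lap M j x.
Proof.
  intros hj; assert (hM := lt_0_INR M ltac:(lia)).
  assert (hjM : INR j + 1 <= INR M) by (rewrite <- S_INR; apply le_INR; lia).
  assert (hj0 := pos_INR j).
  assert (hc : INR M * jval (clamp ((INR j + / 2) / INR M)) = INR j + / 2).
  { rewrite jval_clamp; [field; lra|].
    split; [apply Rdiv_le_0_compat | apply Rle_div_l]; lra. }
  assert (hr : INR M * (/ 2 / INR M) = / 2) by (field; lra).
  exists (clamp ((INR j + / 2) / INR M)), (/ 2 / INR M).
  split; [apply Rdiv_lt_0_compat; lra|].
  unfold ballJ, lap; intros x hx; apply Rabs_lt_between' in hx; nra.
Qed.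

(* A segment meeting three laps contains the middle one; if it only meets two, cut it at their
   common node. *)
Lemma segment_contains_lap_or_half (M : nat) (u v : J) : (0 < M)%nat -> jval u < jval v ->
  (exists j, (j < M)%nat /\ forall x, lap M j x -> segment u v x) \/
  exists j u' v', (j < M)%nat /\ lap M j u' /\ lap M j v' /\
    (forall x, segment u' v' x -> segment u v x) /\
    jval v - jval u <= 2 * (jval v' - jval u').
Proof.
  intros hM huv; assert (hM' := lt_0_INR M hM).
  assert (huv' : INR M * jval u < INR M * jval v) by now apply Rmult_lt_compat_l.
  destruct (lap_exists M u hM) as [j [hj hu]]; unfold lap in hu.
  destruct (Rle_lt_dec (INR M * jval v) (INR j + 1)) as [hv | hv].
  { right; exists j, u, v; unfold lap, segment; repeat split; auto; lra. }
  assert (hj1 : (S j < M)%nat).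
  { apply INR_lt; rewrite S_INR; generalize (jval_bounds v); nra. }
  destruct (Rle_lt_dec (INR j + 2) (INR M * jval v)) as [hv2 | hv2].
  { left; exists (S j); split; [exact hj1|].
    unfold lap, segment; rewrite S_INR; intros x hx.
    split; apply Rmult_le_reg_l with (INR M); lra. }
  assert (hb : INR M * jval (node M (S j)) = INR j + 1).
  { rewrite mult_jval_node, S_INR by lia; reflexivity. }
  set (b := node M (S j)) in *.
  assert (hub : jval u <= jval b) by (apply Rmult_le_reg_l with (INR M); lra).
  assert (hbv : jval b <= jval v) by (apply Rmult_le_reg_l with (INR M); lra).
  right; unfold lap, segment.
  destruct (Rle_lt_dec (jval v - jval u) (2 * (jval b - jval u))).
  - exists j, u, b; repeat split; auto; lra.
  - exists (S j), b, v; rewrite S_INR; repeat split; auto; lra.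
Qed.

(** * Transitivity of maps that expand every lap *)

Lemma open_contains_segment (U : J -> Prop) : openI U -> (exists x, U x) ->
  exists u v, jval u < jval v /\ forall x, segment u v x -> U x.
Proof.
  intros hU [x hx]; destruct (hU x hx) as [r [hr h]].
  generalize (jval_bounds x); intros hx01.
  exists (clamp (jval x - r / 2)), (clamp (jval x + r / 2)); unfold segment; simpl.
  split; [|intros z hz; apply h, Rabs_def1; revert hz];
    unfold Rmax, Rmin; repeat destruct Rle_dec; lra.
Qed.

Definition expands_laps (lam : R) (M : nat) (g : J -> J) : Prop :=
  forall j x y, (j < M)%nat -> lap M j x -> lap M j y ->
    lam * Rabs (jval x - jval y) <= Rabs (jval (g x) - jval (g y)).

Section ExpandingMap.

Variables (g : J -> J) (M : nat) (lam : R).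
Hypothesis M_pos : (0 < M)%nat.
Hypothesis lam_gt2 : 2 < lam.
Hypothesis g_cont : cont_map g.
Hypothesis g_expands : expands_laps lam M g.

Lemma covers_lap_or_longer_segment (U : J -> Prop) (n : nat) (u v : J) :
  jval u < jval v -> covers g n U (segment u v) ->
  (exists j, (j < M)%nat /\ covers g n U (lap M j)) \/
  exists u' v', covers g (S n) U (segment u' v') /\
    lam / 2 * (jval v - jval u) <= jval v' - jval u'.
Proof.
  intros huv hU.
  destruct (segment_contains_lap_or_half M u v M_pos huv)
    as [[j [hj hlap]] | [j [u' [v' [hj [hu' [hv' [hsub hlen]]]]]]]].
  { left; exists j; eauto using covers_subset. }
  right; assert (hu'v' : jval u' <= jval v') by lra.
  assert (hgU := covers_trans (covers_subset hsub hU)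
    (cont_map_covers_segment g u' v' g_cont hu'v')).
  assert (hgrow := g_expands j u' v' hj hu' hv').
  rewrite Rabs_minus_sym, (Rabs_pos_eq (jval v' - jval u')) in hgrow by lra.
  destruct (Rle_lt_dec (jval (g u')) (jval (g v'))) as [hle | hlt].
  - exists (g u'), (g v'); split.
    + apply covers_subset with (2 := hgU); now left.
    + rewrite Rabs_minus_sym, Rabs_pos_eq in hgrow by lra; nra.
  - exists (g v'), (g u'); split.
    + apply covers_subset with (2 := hgU); now right.
    + rewrite Rabs_pos_eq in hgrow by lra; nra.
Qed.

Lemma open_covers_lap (U : J -> Prop) :
  openI U -> (exists x, U x) -> exists n j, (j < M)%nat /\ covers g n U (lap M j).
Proof.
  intros hU hne.
  destruct (open_contains_segment U hU hne) as [u [v [huv hsub]]].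
  assert (hgrow : forall m, (exists n j, (j < M)%nat /\ covers g n U (lap M j)) \/
    exists n u' v', covers g n U (segment u' v') /\
      (lam / 2) ^ m * (jval v - jval u) <= jval v' - jval u').
  { induction m as [|m [IH | [n [u' [v' [hcov hlen]]]]]].
    - right; exists 0%nat, u, v; split; [|simpl; lra].
      intros z hz; exists z; auto.
    - now left.
    - assert (hpow : 0 < (lam / 2) ^ m) by (apply pow_lt; lra).
      destruct (covers_lap_or_longer_segment U n u' v')
        as [hlap | [u'' [v'' [hcov' hlen']]]]; [nra | exact hcov | left; eauto |].
      right; exists (S n), u'', v''; split; [exact hcov' | simpl; nra]. }
  destruct (Pow_x_infinity (lam / 2) ltac:(rewrite Rabs_pos_eq; lra) (2 / (jval v - jval u)))
    as [m hm].
  specialize (hm m (le_n m)); rewrite Rabs_pos_eq in hm by (apply pow_le; lra).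
  apply Rge_le, Rle_div_l in hm; [|lra].
  destruct (hgrow m) as [hlap | [n [u' [v' [_ hlen]]]]]; [exact hlap|].
  generalize (jval_bounds u') (jval_bounds v'); lra.
Qed.

End ExpandingMap.

Section ShadowedOrbits.

Variables (g h : J -> J) (M : nat) (e : R).
Hypothesis M_pos : (0 < M)%nat.
Hypothesis mesh_lt_e : 1 < INR M * e.
Hypothesis g_covers_h :
  forall j x, (j < M)%nat -> lap M j x -> covers g 1 (lap M j) (ballJ (h x) e).

(* The [e]-ball around a point of the orbit contains a lap through that point, and [g] maps this lap
   over the [e]-ball around the next point. *)
Lemma lap_covers_orbit (j : nat) (x : J) (n : nat) : (j < M)%nat -> lap M j x ->
  covers g (S n) (lap M j) (ballJ (Nat.iter (S n) h x) e).
Proof.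
  intros hj hx; induction n as [|n IH]; [now apply g_covers_h|].
  set (s := Nat.iter (S n) h x) in *.
  destruct (lap_exists M s M_pos) as [i [hi hs]].
  apply (@covers_trans g (S n) 1 _ (lap M i)); [|exact (g_covers_h i s hi hs)].
  apply covers_subset with (2 := IH); intros z hz.
  assert (hd := lap_diameter M i z s hz hs); assert (hM := lt_0_INR M M_pos).
  unfold ballJ; nra.
Qed.

Lemma lap_covers_point (j : nat) (q : J) : transitive h ->
  (j < M)%nat -> exists n, covers g (S n) (lap M j) (eq q).
Proof.
  intros htrans hj; assert (hM := lt_0_INR M M_pos).
  assert (he : 0 < e) by nra.
  destruct (lap_contains_ball M j hj) as [c [r [hr hc]]].
  destruct (htrans (ballJ c r) (ballJ q e)) as [[|n] [hn [x [hx hq]]]];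
    try apply ballJ_open; try lia.
  - exists c; unfold ballJ; rewrite Rminus_diag, Rabs_R0; exact hr.
  - exists q; unfold ballJ; rewrite Rminus_diag, Rabs_R0; exact he.
  - exists n; apply covers_subset with (2 := lap_covers_orbit j x n hj (hc x hx)).
    intros z <-; unfold ballJ in *; rewrite Rabs_minus_sym; exact hq.
Qed.

End ShadowedOrbits.

Lemma expanding_perturbation_transitive (g h : J -> J) (M : nat) (lam e : R) : (0 < M)%nat ->
  2 < lam -> cont_map g -> expands_laps lam M g ->
  transitive h -> 1 < INR M * e ->
  (forall j x, (j < M)%nat -> lap M j x -> covers g 1 (lap M j) (ballJ (h x) e)) ->
  transitive g.
Proof.
  intros hM hlam hg hexp hh hmesh hball U V hU _ hne [q hq].
  destruct (open_covers_lap g M lam hM hlam hg hexp U hU hne) as [m [j [hj hlap]]].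
  destruct (lap_covers_point g h M e hM hmesh hball j q hh hj) as [n hn].
  destruct (covers_trans hlap hn q eq_refl) as [x [hx hxq]].
  exists (S n + m)%nat; split; [lia|]; exists x; rewrite hxq; auto.
Qed.

(** * Polygonal maps and zigzags *)

Definition polygonal (y : nat -> J) (M : nat) (x : J) : J :=
  let j := lap_index M x in
  clamp (jval (y j) + (jval (y (S j)) - jval (y j)) * (INR M * jval x - INR j)).

Lemma polygonal_lap (y : nat -> J) (M j : nat) (x : J) : lap M j x ->
  jval (polygonal y M x) =
    jval (y j) + (jval (y (S j)) - jval (y j)) * (INR M * jval x - INR j).
Proof.
  unfold lap, polygonal; intros hx; assert (hi := lap_index_bounds M x).
  set (i := lap_index M x) in *.
  assert (hij : i = j \/ i = S j).
  { assert (i < S (S j))%nat by (apply INR_lt; rewrite !S_INR; lra).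
    assert (j < S i)%nat by (apply INR_lt; rewrite S_INR; lra).
    lia. }
  rewrite jval_clamp.
  - destruct hij as [-> | ->]; [reflexivity|].
    rewrite S_INR in *; replace (INR M * jval x) with (INR j + 1) by lra; ring.
  - generalize (jval_bounds (y i)) (jval_bounds (y (S i))); nra.
Qed.

Lemma polygonal_node (y : nat -> J) (M j : nat) : (0 < M)%nat -> (j <= M)%nat ->
  polygonal y M (node M j) = y j.
Proof.
  intros hM hj; apply jval_inj.
  rewrite (polygonal_lap y M j), mult_jval_node by auto using lap_node_left; ring.
Qed.

Lemma polygonal_piecewise_linear (y : nat -> J) (M : nat) : (0 < M)%nat ->
  piecewise_linear (polygonal y M).
Proof.
  intros hM; assert (hM' := lt_0_INR M hM).
  exists M, (fun i => INR i / INR M); split.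
  - split; [simpl; field; lra | split; [field; lra|]].
    intros i _; rewrite S_INR; apply Rmult_lt_compat_r; [now apply Rinv_0_lt_compat | lra].
  - intros i _; set (s := jval (y (S i)) - jval (y i)).
    exists (s * INR M), (jval (y i) - s * INR i).
    intros x [hl hr]; apply Rle_div_l in hl; [|lra]; apply Rle_div_r in hr; [|lra].
    rewrite S_INR in hr; rewrite (polygonal_lap y M i); [unfold s; ring | unfold lap; lra].
Qed.

Lemma polygonal_expands_laps (y : nat -> J) (M : nat) (a : R) :
  (forall j, (j < M)%nat -> a <= Rabs (jval (y (S j)) - jval (y j))) ->
  expands_laps (INR M * a) M (polygonal y M).
Proof.
  intros hgap j u v hj hu hv; rewrite !(polygonal_lap y M j) by assumption.
  set (s := jval (y (S j)) - jval (y j)).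
  replace (jval (y j) + s * (INR M * jval u - INR j)
      - (jval (y j) + s * (INR M * jval v - INR j)))
    with (s * (INR M * (jval u - jval v))) by ring.
  rewrite !Rabs_mult, (Rabs_pos_eq (INR M)) by apply pos_INR.
  replace (Rabs s * (INR M * Rabs (jval u - jval v)))
    with (INR M * Rabs s * Rabs (jval u - jval v)) by ring.
  apply Rmult_le_compat_r; [apply Rabs_pos|].
  apply Rmult_le_compat_l; [apply pos_INR | exact (hgap j hj)].
Qed.

Lemma polygonal_covers_lap (y : nat -> J) (M j : nat) : (j < M)%nat ->
  covers (polygonal y M) 1 (lap M j)
    (fun z => segment (y j) (y (S j)) z \/ segment (y (S j)) (y j) z).
Proof.
  intros hj z hz.
  assert (hl := mult_jval_node M j ltac:(lia) ltac:(lia)).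
  assert (hr := mult_jval_node M (S j) ltac:(lia) hj); rewrite S_INR in hr.
  assert (hM := lt_0_INR M ltac:(lia)).
  assert (hcont := piecewise_linear_cont_map _ (polygonal_piecewise_linear y M ltac:(lia))).
  destruct (cont_map_covers_segment _ (node M j) (node M (S j)) hcont) with z
    as [x [hx hxz]].
  - apply Rmult_le_reg_l with (INR M); lra.
  - now rewrite !polygonal_node by lia.
  - exists x; split; [|exact hxz]; unfold segment, lap in *; nra.
Qed.

Lemma Rabs_convex_le (p q t e : R) : 0 <= t <= 1 -> Rabs p <= e -> Rabs q <= e ->
  Rabs (p + (q - p) * t) <= e.
Proof.
  intros ht hp hq; apply Rabs_le_between in hp, hq; apply Rabs_le; nra.
Qed.

Lemma polygonal_dist (y z : nat -> J) (M : nat) (e : R) :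
  (forall j, Rabs (jval (y j) - jval (z j)) <= e) ->
  dsup (polygonal y M) (polygonal z M) <= e.
Proof.
  intros h; apply dsup_le; intros x; assert (hx := lap_index_bounds M x).
  rewrite !(polygonal_lap _ M (lap_index M x)) by (unfold lap; lra).
  set (j := lap_index M x) in *.
  replace (_ - _) with ((jval (y j) - jval (z j)) +
    ((jval (y (S j)) - jval (z (S j))) - (jval (y j) - jval (z j))) *
      (INR M * jval x - INR j)) by ring.
  apply Rabs_convex_le; auto; lra.
Qed.

Lemma polygonal_close (f : J -> J) (y : nat -> J) (M : nat) (e : R) : (0 < M)%nat ->
  (forall j x, (j < M)%nat -> lap M j x ->
    Rabs (jval (y j) - jval (f x)) <= e /\ Rabs (jval (y (S j)) - jval (f x)) <= e) ->
  dsup f (polygonal y M) <= e.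
Proof.
  intros hM h; rewrite dsup_comm; apply dsup_le; intros x.
  destruct (lap_exists M x hM) as [j [hj hx]].
  destruct (h j x hj hx) as [hl hr].
  rewrite (polygonal_lap y M j x hx).
  replace (_ - _) with ((jval (y j) - jval (f x)) +
    ((jval (y (S j)) - jval (f x)) - (jval (y j) - jval (f x))) *
      (INR M * jval x - INR j)) by ring.
  unfold lap in hx; apply Rabs_convex_le; auto; lra.
Qed.

Definition zig_value (f : J -> J) (a : R) (M j : nat) : J :=
  let v := jval (f (node M j)) in clamp (if Nat.even j then v + a else v - a).

Definition zigzag (f : J -> J) (a : R) (M : nat) : J -> J :=
  polygonal (zig_value f a M) M.

Lemma zig_value_dist (f h : J -> J) (a b : R) (M j : nat) :
  Rabs (jval (zig_value f a M j) - jval (zig_value h b M j)) <= dsup f h + Rabs (a - b).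
Proof.
  apply Rle_trans with (1 := clamp_nonexpansive _ _).
  generalize (dist_le_dsup f h (node M j)).
  destruct (Nat.even j); split_Rabs; lra.
Qed.

Lemma zig_value_close (f : J -> J) (a : R) (M j : nat) :
  Rabs (jval (zig_value f a M j) - jval (f (node M j))) <= Rabs a.
Proof.
  rewrite <- (clamp_jval (f (node M j))).
  apply Rle_trans with (1 := clamp_nonexpansive _ _).
  destruct (Nat.even j); split_Rabs; lra.
Qed.

Lemma zigzag_dist (f h : J -> J) (a b : R) (M : nat) :
  dsup (zigzag f a M) (zigzag h b M) <= dsup f h + Rabs (a - b).
Proof. apply polygonal_dist; intros j; apply zig_value_dist. Qed.

(* The bound [4 < INR M * a] makes the zigzag expand laps by more than [4] and makes the laps
   shorter than [a / 4]. *)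
Definition fine_mesh (f : J -> J) (a : R) (M : nat) : Prop :=
  0 < a <= 1 /\ 4 < INR M * a /\
  forall j x y, lap M j x -> lap M j y -> Rabs (jval (f x) - jval (f y)) <= a / 2.

Section FineZigzag.

Context {f : J -> J} {a : R} {M : nat}.
Hypothesis fine : fine_mesh f a M.

Lemma fine_mesh_amplitude : 0 < a <= 1.
Proof. apply fine. Qed.

Lemma fine_mesh_pos : (0 < M)%nat.
Proof.
  destruct fine as [ha [hMa _]].
  apply INR_lt; simpl; nra.
Qed.

Lemma fine_zigzag_close : dsup f (zigzag f a M) <= 2 * a.
Proof.
  assert (hM := fine_mesh_pos); destruct fine as [ha [_ hosc]].
  apply polygonal_close; [exact hM|]; intros j x hj hx.
  generalize (hosc j _ x (lap_node_left M j hM ltac:(lia)) hx)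
    (hosc j _ x (lap_node_right M j hj) hx)
    (zig_value_close f a M j) (zig_value_close f a M (S j)).
  split; split_Rabs; lra.
Qed.

Lemma fine_zig_value_gap (j : nat) : (j < M)%nat ->
  if Nat.even j
  then jval (zig_value f a M (S j)) + a <= jval (zig_value f a M j)
  else jval (zig_value f a M j) + a <= jval (zig_value f a M (S j)).
Proof.
  intros hj; assert (hM := fine_mesh_pos); destruct fine as [ha [_ hosc]].
  generalize (hosc j _ _ (lap_node_left M j hM ltac:(lia)) (lap_node_right M j hj))
    (jval_bounds (f (node M j))) (jval_bounds (f (node M (S j)))).
  intros hd; apply Rabs_le_between in hd.
  unfold zig_value; rewrite Nat.even_succ, <- Nat.negb_even.
  destruct (Nat.even j); simpl; unfold Rmin, Rmax; repeat destruct Rle_dec; lra.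
Qed.

Lemma fine_zigzag_expands_laps : expands_laps (INR M * a) M (zigzag f a M).
Proof.
  apply polygonal_expands_laps; intros j hj.
  assert (hgap := fine_zig_value_gap j hj).
  destruct (Nat.even j); split_Rabs; lra.
Qed.

Lemma fine_zigzag_covers_ball (j : nat) (x : J) : (j < M)%nat -> lap M j x ->
  covers (zigzag f a M) 1 (lap M j) (ballJ (f x) (a / 2)).
Proof.
  intros hj hx; assert (hM := fine_mesh_pos); destruct fine as [ha [_ hosc]].
  apply covers_subset with (2 := polygonal_covers_lap _ M j hj); intros z hz.
  generalize (hosc j _ x (lap_node_left M j hM ltac:(lia)) hx)
    (hosc j _ x (lap_node_right M j hj) hx) (jval_bounds z).
  intros hl hr; apply Rabs_le_between' in hl, hr; apply Rabs_lt_between' in hz.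
  unfold segment, zig_value; rewrite Nat.even_succ, <- Nat.negb_even.
  destruct (Nat.even j); simpl; [right | left];
    unfold Rmin, Rmax; repeat destruct Rle_dec; lra.
Qed.

Lemma fine_zigzag_transitive : TI_closure f -> transitive (zigzag f a M).
Proof.
  intros [_ hf]; destruct fine as [ha [hMa _]].
  destruct (hf (a / 4)) as [h [[_ hh] hfh]]; [lra|].
  apply expanding_perturbation_transitive with (h := h) (M := M) (lam := INR M * a) (e := a / 4);
    try assumption; try lra.
  - exact fine_mesh_pos.
  - apply piecewise_linear_cont_map, polygonal_piecewise_linear, fine_mesh_pos.
  - exact fine_zigzag_expands_laps.
  - intros j x hj hx.
    apply covers_subset with (2 := fine_zigzag_covers_ball j x hj hx).
    unfold ballJ; intros z hz; generalize (dist_le_dsup f h x); split_Rabs; lra.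
Qed.

Lemma fine_zigzag_TPL : TI_closure f -> TPL (zigzag f a M).
Proof.
  intros hf.
  assert (hpl : piecewise_linear (zigzag f a M)).
  { apply polygonal_piecewise_linear, fine_mesh_pos. }
  split; [split|].
  - now apply piecewise_linear_cont_map.
  - now apply fine_zigzag_transitive.
  - exact hpl.
Qed.

End FineZigzag.

(* On its first lap the coarser zigzag decreases, while on its second lap, contained in it, the
   finer one climbs by [a]. *)
Lemma fine_zigzag_separated {f h : J -> J} {a b : R} {M N : nat} :
  fine_mesh f a M -> fine_mesh h b N -> (2 * N <= M)%nat ->
  a <= 2 * dsup (zigzag f a M) (zigzag h b N).
Proof.
  intros hf hh hNM.
  assert (hM := fine_mesh_pos hf); assert (hN := fine_mesh_pos hh).
  assert (hb := fine_mesh_amplitude hh).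
  assert (hlap : forall i, (i <= 2)%nat -> lap N 0 (node M i)).
  { intros i hi; assert (hx := mult_jval_node M i hM ltac:(lia)).
    apply le_INR in hNM; rewrite mult_INR in hNM; apply le_INR in hi.
    assert (hx01 := jval_bounds (node M i)); assert (hN0 := pos_INR N).
    unfold lap; simpl in *; split; nra. }
  assert (climb := fine_zig_value_gap hf 1 ltac:(lia)).
  assert (descend := fine_zig_value_gap hh 0 ltac:(lia)).
  cbn [Nat.even] in climb, descend.
  assert (h1 := dist_le_dsup (zigzag f a M) (zigzag h b N) (node M 1)).
  assert (h2 := dist_le_dsup (zigzag f a M) (zigzag h b N) (node M 2)).
  revert h1 h2; set (d := dsup _ _); unfold zigzag.
  rewrite !polygonal_node, !(polygonal_lap _ N 0) by (try apply hlap; lia).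
  assert (hx : jval (node M 1) <= jval (node M 2)).
  { apply Rmult_le_reg_l with (INR M); [now apply lt_0_INR|].
    rewrite !mult_jval_node by lia; simpl; lra. }
  apply (Rmult_le_compat_l (INR N)) in hx; [|apply pos_INR].
  intros h1 h2; apply Rabs_le_between in h1, h2; nra.
Qed.

(** * Fine meshes for compact families *)

Lemma fine_mesh_near (f : J -> J) (a : R) : cont_map f -> 0 < a ->
  exists r m, 0 < r /\ forall h b M, dsup f h < r -> Rabs (b - a) < r -> b <= 1 ->
    (m <= M)%nat -> fine_mesh h b M.
Proof.
  intros hf ha.
  destruct (cont_map_uniform f (a / 8) hf ltac:(lra)) as [d [hd hunif]].
  destruct (INR_unbounded (Rmax (8 / a) (/ d))) as [m hm].
  exists (a / 16), m; split; [lra|]; intros h b M hfh hb hb1 hM.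
  apply le_INR in hM.
  assert (hMa : 8 < INR M * a).
  { apply Rlt_div_l; [lra|].
    generalize (Rmax_l (8 / a) (/ d)); lra. }
  assert (hMd : 1 < INR M * d).
  { apply Rlt_div_l; [lra|]; generalize (Rmax_r (8 / a) (/ d)); lra. }
  assert (hM0 : 0 < INR M) by nra.
  apply Rabs_lt_between' in hb.
  split; [lra|]; split; [nra|]; intros j x y hx hy.
  assert (hxy := lap_diameter M j x y hx hy).
  generalize (hunif x y ltac:(nra)) (dist_le_dsup f h x) (dist_le_dsup f h y).
  split_Rabs; lra.
Qed.

Lemma compact_eventually {K : Type} (dK : K -> K -> R) (P : nat -> K -> Prop) :
  is_metric dK -> compact_metric dK ->
  (forall k0, exists r m, 0 < r /\ forall k n, dK k0 k < r -> (m <= n)%nat -> P n k) ->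
  exists m, forall k n, (m <= n)%nat -> P n k.
Proof.
  intros [_ [hd0 [_ htri]]] hK hloc.
  destruct (hK (fun U => openK dK U /\ exists m, forall k n, U k -> (m <= n)%nat -> P n k))
    as [l [hl hcov]].
  - now intros U [].
  - intros k0; destruct (hloc k0) as [r [m [hr hm]]].
    exists (fun k => dK k0 k < r); split; [split; [|now exists m]|].
    + intros k hk; exists (r - dK k0 k); split; [lra|].
      intros k' hk'; generalize (htri k0 k k'); lra.
    + now rewrite (proj2 (hd0 k0 k0) eq_refl).
  - assert (hmax : exists m, forall U, In U l -> forall k n, U k -> (m <= n)%nat -> P n k).
    { clear hcov; induction l as [|U l IH]; [now exists 0%nat|].
      destruct IH as [m hm]; [intros V hV; apply hl; now right|].
      destruct (hl U (or_introl eq_refl)) as [_ [m' hm']].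
      exists (Nat.max m m'); intros V [<- | hV] k n hk hn.
      - apply hm'; [exact hk | lia].
      - apply (hm V hV); [exact hk | lia]. }
    destruct hmax as [m hm]; exists m; intros k n hn.
    destruct (hcov k) as [U [hU hk]]; eauto.
Qed.

Definition cont_real {K : Type} (dK : K -> K -> R) (a : K -> R) : Prop :=
  forall k e, 0 < e -> exists delta, 0 < delta /\
    forall k', dK k k' < delta -> Rabs (a k' - a k) < e.

Lemma cont_on_comp {K : Type} (dK : K -> K -> R) (X : (J -> J) -> Prop)
    (eps : (J -> J) -> R) (f : K -> J -> J) :
  cont_on X eps -> (forall k, X (f k)) -> cont_into dK f ->
  cont_real dK (fun k => eps (f k)).
Proof.
  intros heps hX hf k e he.
  destruct (heps (f k) (hX k) e he) as [d [hd h]].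
  destruct (hf k d hd) as [d' [hd' h']]; eauto.
Qed.

Lemma fine_mesh_exists {K : Type} (dK : K -> K -> R) (f : K -> J -> J) (a : K -> R) :
  is_metric dK -> compact_metric dK -> (forall k, cont_map (f k)) -> cont_into dK f ->
  cont_real dK a -> (forall k, 0 < a k <= 1) ->
  exists m, forall k M, (m <= M)%nat -> fine_mesh (f k) (a k) M.
Proof.
  intros hd hK hfcont hf ha ha01.
  apply (compact_eventually dK); auto; intros k0.
  destruct (fine_mesh_near (f k0) (a k0)) as [r [m [hr hfine]]]; [auto | apply ha01 |].
  destruct (hf k0 r hr) as [d1 [hd1 h1]]; destruct (ha k0 r hr) as [d2 [hd2 h2]].
  exists (Rmin d1 d2), m; split; [now apply Rmin_glb_lt|]; intros k M hk hM.
  apply Rmin_Rgt_l in hk as [hk1 hk2].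
  apply hfine; auto; apply ha01.
Qed.

Lemma zigzag_cont_into {K : Type} (dK : K -> K -> R) (f : K -> J -> J) (a : K -> R)
    (M : nat) :
  cont_into dK f -> cont_real dK a -> cont_into dK (fun k => zigzag (f k) (a k) M).
Proof.
  intros hf ha k e he.
  destruct (hf k (e / 2)) as [d1 [hd1 h1]]; [lra|].
  destruct (ha k (e / 2)) as [d2 [hd2 h2]]; [lra|].
  exists (Rmin d1 d2); split; [now apply Rmin_glb_lt|]; intros k' hk.
  apply Rmin_Rgt_l in hk as [hk1 hk2].
  apply Rle_lt_trans with (1 := zigzag_dist _ _ _ _ M).
  rewrite (Rabs_minus_sym (a k)); generalize (h1 k' hk1) (h2 k' hk2); lra.
Qed.

Fixpoint doubling (mu : nat -> nat) (n : nat) : nat :=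
  match n with
  | O => mu O
  | S n' => (mu (S n') + 2 * doubling mu n')%nat
  end.

Lemma doubling_ge (mu : nat -> nat) (n : nat) : (mu n <= doubling mu n)%nat.
Proof. destruct n; simpl; lia. Qed.

Lemma doubling_double_le (mu : nat -> nat) (m n : nat) :
  (m < n)%nat -> (2 * doubling mu m <= doubling mu n)%nat.
Proof. induction 1; simpl in *; lia. Qed.

(** * Discreteness and the approximation property *)

(* If [alpha f] is small, then [f] is as near to [p] as [g] is, and [alpha] is positive at [p]. *)
Lemma perturbation_size_bounded_below (X : (J -> J) -> Prop) (alpha : (J -> J) -> R)
    (p : J -> J) :
  cont_on X alpha -> X p -> 0 < alpha p ->
  exists r c, 0 < r /\ 0 < c /\ forall f g, X f -> dsup f g <= 2 * alpha f ->
    dsup p g < r -> c <= alpha f.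
Proof.
  intros halpha hp hpos.
  destruct (halpha p hp (alpha p / 2)) as [d [hd h]]; [lra|].
  exists (d / 2), (Rmin (d / 4) (alpha p / 2)).
  split; [lra|]; split; [apply Rmin_glb_lt; lra|]; intros f g hf hfg hpg.
  destruct (Rle_lt_dec (d / 4) (alpha f)) as [hge | hlt].
  - apply Rle_trans with (2 := hge), Rmin_l.
  - apply Rle_trans with (1 := Rmin_r _ _).
    assert (htri := dsup_triangle p g f); rewrite (dsup_comm g f) in htri.
    specialize (h f hf ltac:(lra)); split_Rabs; lra.
Qed.

Lemma zigzag_family_discrete {K : Type} (X : (J -> J) -> Prop) (alpha : (J -> J) -> R)
    (f : K -> nat -> J -> J) (M : nat -> nat) :
  cont_on X alpha -> (forall p, X p -> 0 < alpha p) -> (forall k n, X (f k n)) ->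
  (forall k n, fine_mesh (f k n) (alpha (f k n)) (M n)) ->
  (forall m n, (m < n)%nat -> (2 * M m <= M n)%nat) ->
  discrete_family X (fun k n => zigzag (f k n) (alpha (f k n)) (M n)).
Proof.
  intros halpha hpos hX hfine hM p hp.
  set (g := fun k n => zigzag (f k n) (alpha (f k n)) (M n)).
  destruct (perturbation_size_bounded_below X alpha p halpha hp (hpos p hp))
    as [r [c [hr [hc hbelow]]]].
  assert (hsep : forall m n k l, (m < n)%nat ->
    dsup p (g k m) < Rmin r (c / 4) -> dsup p (g l n) < Rmin r (c / 4) -> False).
  { intros m n k l hmn hm hn.
    apply Rmin_Rgt_l in hm as [_ hm]; apply Rmin_Rgt_l in hn as [hnr hn].
    assert (hamp := hbelow _ _ (hX l n) (fine_zigzag_close (hfine l n)) hnr).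
    assert (hdist := fine_zigzag_separated (hfine l n) (hfine k m) (hM m n hmn)).
    assert (htri := dsup_triangle (g l n) p (g k m)); rewrite (dsup_comm (g l n) p) in htri.
    unfold g in *; lra. }
  exists (Rmin r (c / 4)); split; [apply Rmin_glb_lt; lra|].
  intros m n [k hk] [l hl].
  destruct (Nat.lt_trichotomy m n) as [hmn | [hmn | hnm]].
  - destruct (hsep m n k l hmn hk hl).
  - exact hmn.
  - destruct (hsep n m l k hnm hl hk).
Qed.

Theorem SDAP_between (X : (J -> J) -> Prop) :
  (forall f, TPL f -> X f) -> (forall f, X f -> TI_closure f) -> SDAP X.
Proof.
  intros hlow hup eps heps hceps K dK hd hK f hX hf.
  set (alpha := fun h => eps h / 4).
  assert (halpha : forall h, X h -> 0 < alpha h <= 1).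
  { intros h hh; generalize (heps h hh); unfold alpha; lra. }
  assert (hcalpha : cont_on X alpha).
  { intros h hh e he; destruct (hceps h hh e he) as [d [hd0 hlt]].
    exists d; split; [exact hd0|]; intros h' hh' hdist.
    generalize (hlt h' hh' hdist); unfold alpha; split_Rabs; lra. }
  assert (hcomp : forall n, cont_real dK (fun k => alpha (f k n))).
  { intros n; apply cont_on_comp with (X := X); auto. }
  destruct (functional_choice (fun n m => forall k M, (m <= M)%nat ->
    fine_mesh (f k n) (alpha (f k n)) M)) as [mu hmu].
  { intros n; apply (fine_mesh_exists dK (fun k => f k n) (fun k => alpha (f k n))); auto.
    intros k; apply (hup _ (hX k n)). }
  assert (hfine : forall k n, fine_mesh (f k n) (alpha (f k n)) (doubling mu n)).
  { intros k n; apply hmu, doubling_ge. }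
  exists (fun k n => zigzag (f k n) (alpha (f k n)) (doubling mu n)); repeat split.
  - intros k n; apply hlow, fine_zigzag_TPL; auto.
  - intros n; apply zigzag_cont_into; auto.
  - apply zigzag_family_discrete; auto using doubling_double_le.
    intros h hh; apply (halpha h hh).
  - intros k n; generalize (fine_zigzag_close (hfine k n)) (heps _ (hX k n)).
    unfold alpha; lra.
Qed.

Theorem theorem3 : SDAP TI_closure /\ SDAP TI /\ SDAP TPL /\ SDAP TPM.
Proof.
  repeat split; apply SDAP_between; unfold TPL, TPM;
    intuition auto using TI_incl_closure, piecewise_linear_monotone.
Qed.
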